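(* Suppose $fD=P\bar P$ with $P\neq\bar P$ prime ideals of $D$; let $m$ be the order of $P$ in the class group of $D$ and let $\beta\in D$ be a generator of $P^m$. For each $n\in\mathbb{N}$ (including $n=0$), let $t_n = f \beta^n$. An element $t\in O$ is basic if and only if $t$ is associated in $D$ either to $t_n$ or to its conjugate $\bar t_n$, for some $n\in\mathbb{N}$. Moreover, the principal ideals $t_n w O$ and $\bar{t}_n w' O$, for $n>0$ and $w,w'\in D^*$, where units are taken modulo $O^*$ (two units $w,w'\in D^*$ are regarded as different when $w/w'\notin O$), are pairwise incomparable with respect to inclusion and do not contain $\mathfrak{F}^2$.
   Context: Let $d$ be a square-free integer ($d\neq 1$), $K=\mathbb{Q}(\sqrt d)$ and $D=\mathbb{Z}[\omega]$ its ring of integers, where $\omega=\sqrt d$ if $d\equiv 2,3 \pmod 4$ and $\omega=(1+\sqrt d)/2$ if $d\equiv 1\pmod 4$. Let $f$ be a prime number and $O=\mathbb{Z}[f\omega]$, the unique order of $K$ with $[D:O]=f$. The conductor of $O$ is $\mathfrak{F}=\{x\in O: xD\subseteq O\}=fD$; it is a prime ideal of $O$. $D^*$, $O^*$ are the unit groups. A bar denotes conjugation in $K$. The order $m$ of $P$ is the least positive integer such that $P^m$ is principal. An ideal of $O$ is $\mathfrak{F}$-primary if it is primary with radical $\mathfrak{F}$; an $\mathfrak{F}$-primary ideal is basic if it is not contained in $\mathfrak{F}^2$. An element $t\in O$ is basic if $tO$ is a basic $\mathfrak{F}$-primary ideal. Two elements are associated in $D$ if their quotient is a unit of $D$. The pairwise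 incomparability means: if $W\subseteq D^*$ is a set of representatives of $D^*/O^*$, then any two ideals in the family $t_nwO$, $\bar t_n w O$ ($n>0$, $w\in W$) with different indexing data are such that neither contains the other. *)

(* Defs.v *)
From HB Require Import structures.
From mathcomp Require Import all_boot all_order all_algebra all_field.
From mathcomp Require Import boolp classical_sets.

Set Implicit Arguments.
Unset Strict Implicit.
Unset Printing Implicit Defensive.

Import Order.TTheory GRing.Theory Num.Theory.

Local Open Scope classical_set_scope.
Local Open Scope ring_scope.

(* Subrings of a field K, and the ideals of such a subring A, are represented
   as sets of elements of K; the subring A is an explicit parameter. *)

Definition Zadjoin (K : fieldType) (x : K) : set K :=
  [set y | exists p : {poly int}, y = (map_poly intr p).[x]].

Definition is_ideal (K : fieldType) (A I : set K) : Prop :=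
  [/\ I `<=` A, I 0, (forall x y, I x -> I y -> I (x + y))
    & (forall a x, A a -> I x -> I (a * x))].

Definition prime_ideal (K : fieldType) (A P : set K) : Prop :=
  [/\ is_ideal A P, ~ P 1
    & forall x y, A x -> A y -> P (x * y) -> P x \/ P y].

Definition primary_ideal (K : fieldType) (A Q : set K) : Prop :=
  [/\ is_ideal A Q, ~ Q 1
    & forall x y, A x -> A y -> Q (x * y) ->
        Q x \/ exists2 n : nat, (0 < n)%N & Q (y ^+ n)].

Definition radical (K : fieldType) (A I : set K) : set K :=
  [set x | A x /\ exists2 n : nat, (0 < n)%N & I (x ^+ n)].

Definition ideal_mul (K : fieldType) (I J : set K) : set K :=
  [set x | exists n : nat, exists u v : 'I_n -> K,
     [/\ (forall i, I (u i)), (forall i, J (v i)) & x = \sum_(i < n) u i * v i]].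

Definition ideal_exp (K : fieldType) (A I : set K) (n : nat) : set K :=
  iter n (ideal_mul I) A.

Definition principal (K : fieldType) (A : set K) (x : K) : set K :=
  [set y | exists2 a, A a & y = x * a].

Definition is_principal (K : fieldType) (A I : set K) : Prop :=
  exists2 x, A x & I = principal A x.

Definition class_order (K : fieldType) (A P : set K) (m : nat) : Prop :=
  [/\ (0 < m)%N, is_principal A (ideal_exp A P m)
    & forall k : nat, (0 < k)%N -> is_principal A (ideal_exp A P k) ->
        (m <= k)%N].

Definition units (K : fieldType) (A : set K) : set K :=
  [set u | A u /\ exists2 v, A v & u * v = 1].

Definition associated (K : fieldType) (A : set K) (x y : K) : Prop :=
  units A (x / y).

(* W contains exactly one element of each class of units D / units O. *)
Definition unit_representatives (K : fieldType) (D O W : set K) : Prop :=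
  W `<=` units D /\
  forall u, units D u -> exists! w, W w /\ units O (u / w).

Definition conductor (K : fieldType) (D O : set K) : set K :=
  [set x | O x /\ forall y, D y -> O (x * y)].

Definition basic_ideal (K : fieldType) (A F Q : set K) : Prop :=
  [/\ primary_ideal A Q, radical A Q = F & ~ (Q `<=` ideal_exp A F 2)].

Definition basic_element (K : fieldType) (A F : set K) (t : K) : Prop :=
  A t /\ basic_ideal A F (principal A t).

Definition incomparable (K : fieldType) (I J : set K) : Prop :=
  ~ (I `<=` J) /\ ~ (J `<=` I).

(* 0 is not square-free: every n ^ 2 divides it. *)
Definition squarefree (d : int) : Prop :=
  forall n : nat, (n ^ 2 %| `|d|)%N -> n = 1%N.

(* K is Q(s) where s is a square root of d. *)
Definition is_quadratic_field (d : int) (K : fieldExtType rat) (s : K) : Prop :=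
  s ^+ 2 = d%:~R /\ <<1; s>>%VS = fullv.

(* x = a + b * s is sent to a - b * s; a and b are the coordinates of x in the
   basis (1, s) of K over rat. *)
Definition qconj (K : fieldExtType rat) (s x : K) : K :=
  coord [tuple 1; s] ord0 x *: 1 - coord [tuple 1; s] ord_max x *: s.

Definition omega (d : int) (K : fieldExtType rat) (s : K) : K :=
  if (d == 1 %[mod 4])%Z then (1 + s) / 2 else s.

Definition max_order (d : int) (K : fieldExtType rat) (s : K) : set K :=
  Zadjoin (omega d s).

Definition order_of_index (d : int) (K : fieldExtType rat) (s : K) (f : nat) :
    set K :=
  Zadjoin (f%:R * omega d s).

Definition tseq (K : fieldType) (f : nat) (beta : K) (n : nat) : K :=
  f%:R * beta ^+ n.

(* The index (false, n, w) stands for the ideal t_n w O, and (true, n, w) for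
   the ideal generated by w times the conjugate of t_n. *)
Definition t_ideal (K : fieldExtType rat) (s : K) (f : nat) (beta : K)
    (O : set K) (i : bool * nat * K) : set K :=
  let: (b, n, w) := i in
  principal O ((if b then qconj s (tseq f beta n) else tseq f beta n) * w).

(* Main.v *)
Require Import Defs.
From HB Require Import structures.
From mathcomp Require Import all_boot all_order all_algebra all_field.
From mathcomp Require Import boolp classical_sets.
From mathcomp Require Import ring.

Set Implicit Arguments.
Unset Strict Implicit.
Unset Printing Implicit Defensive.

Import Order.TTheory GRing.Theory Num.Theory.

Local Open Scope classical_set_scope.
Local Open Scope ring_scope.

(** Write [x'] for the conjugate of [x], [P'] for that of [P] (the ideal [Q] of the
    lemmas), and [F = fD] for the conductor, so that [O = Z + F] and
    [F^2 = f^2 D].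

    The ring [O / F] is the field of [f] elements. Hence an ideal [tO] inside [F]
    is [F]-primary exactly when it contains a power of [f], and a basic element is
    the same thing as [t = f g] where [g] in [D] divides a power of [f] in [D] and
    is not itself divisible by [f] ([basic_elementE]).

    Since [f] does not divide [g] and [fD = P P'] is the intersection of [P] and
    [P'], one of the two primes does not contain [g], say [P'] does not. As the
    norm of [g] is [+- f^a] for some [a], this forces [gD = P^a]. No general
    factorization theorem enters: an element outside a prime ideal above [f] is
    invertible modulo it, because its norm or its trace is an integer prime to
    [f] ([prime_ideal_comaximal]), and this gives the two inclusions
    ([prime_power_of_dvd]). The order [m] of [P] must divide [a]
    ([principal_exp_generator]), so [g] is associated to a power of [beta]. The
    other case follows by conjugation, and conversely powers of [beta] and [beta']
    satisfy the criterion, since [beta] divides [f^m] and does not lie in [P'].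

    The incomparability and the noninclusion of [F^2] come from comparing
    membership in [P] and [P']: [beta] lies in [P] but not in [P'], [beta'] in
    [P'] but not in [P], while an element of [O] lying in one of these primes lies
    in [F] and hence in both ([order_prime_sub]). This leaves only inclusions
    between ideals with the same generator up to a unit of [D] that lies in [O],
    which is then a unit of [O] ([units_order]). *)

(** * Products and powers of ideals in a subring of a field *)

Section IdealProducts.

Variable K : fieldType.
Implicit Types A I J L X : set K.

Lemma mem_ideal_mul I J x y : I x -> J y -> ideal_mul I J (x * y).
Proof.
by move=> Ix Jy; exists 1%N, (fun=> x), (fun=> y); rewrite big_ord1.
Qed.

Lemma ideal_mul0 I J : ideal_mul I J 0.
Proof. by exists 0%N, (fun=> 0), (fun=> 0); rewrite big_ord0; split=> // -[]. Qed.

Lemma ideal_mulD I J x y :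
  ideal_mul I J x -> ideal_mul I J y -> ideal_mul I J (x + y).
Proof.
move=> [n [u [v [Iu Jv ->]]]] [n' [u' [v' [Iu' Jv' ->]]]].
exists (n + n')%N.
exists (fun i => match split i with inl j => u j | inr j => u' j end).
exists (fun i => match split i with inl j => v j | inr j => v' j end).
split=> [i|i|]; try by case: splitP.
rewrite big_split_ord /=; congr (_ + _); apply: eq_bigr => i _.
  by rewrite (unsplitK (inl i)).
by rewrite (unsplitK (inr i)).
Qed.

Lemma ideal_mul_subset I J X :
  X 0 -> (forall x y, X x -> X y -> X (x + y)) ->
  (forall x y, I x -> J y -> X (x * y)) -> ideal_mul I J `<=` X.
Proof.
move=> X0 XD XM _ [n [u [v [Iu Jv ->]]]].
by elim/big_ind: _ => // i _; apply: XM.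
Qed.

Lemma ideal_mulC I J : ideal_mul I J = ideal_mul J I.
Proof.
by apply/seteqP; split; apply: ideal_mul_subset;
  do ?[exact: ideal_mul0|exact: ideal_mulD] => x y Ix Jy;
  rewrite mulrC; apply: mem_ideal_mul.
Qed.

Lemma ideal_mulA I J L :
  ideal_mul I (ideal_mul J L) = ideal_mul (ideal_mul I J) L.
Proof.
have half I' J' L' : ideal_mul I' (ideal_mul J' L') `<=`
    ideal_mul (ideal_mul I' J') L'.
  apply: ideal_mul_subset (@ideal_mul0 _ _) (@ideal_mulD _ _) _ => x y I'x.
  apply: (ideal_mul_subset
    (X := [set y | ideal_mul (ideal_mul I' J') L' (x * y)])).
  - by rewrite /= mulr0; apply: ideal_mul0.
  - by move=> a b /= ha hb; rewrite mulrDr; apply: ideal_mulD.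
  - by move=> a b J'a L'b /=; rewrite mulrA; do ?apply: mem_ideal_mul.
apply/seteqP; split; first exact: half.
rewrite [X in X `<=` _]ideal_mulC [X in _ `<=` X]ideal_mulC.
by rewrite (ideal_mulC I J) (ideal_mulC J L); apply: half.
Qed.

Section Subring.

Variable A : set K.
Hypotheses (A1 : A 1) (AB : forall x y, A x -> A y -> A (x - y))
  (AM : forall x y, A x -> A y -> A (x * y)).

Lemma subring0 : A 0. Proof. by rewrite -(subrr 1); apply: AB. Qed.

Lemma subringN x : A x -> A (- x).
Proof. by rewrite -sub0r; apply: AB; apply: subring0. Qed.

Lemma subringD x y : A x -> A y -> A (x + y).
Proof. by move=> Ax Ay; rewrite -[y]opprK; apply/AB/subringN. Qed.

Lemma subringX x n : A x -> A (x ^+ n).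
Proof. by move=> Ax; elim: n => [|n IHn] //; rewrite exprS; apply: AM. Qed.

Lemma subring_nat n : A n%:R.
Proof.
elim: n => [|n IHn]; first exact: subring0.
by rewrite -natr1; apply: subringD.
Qed.

Lemma subring_int (a : int) : A a%:~R.
Proof.
case: a => n; first exact: subring_nat.
by rewrite NegzE mulrNz; apply/subringN/subring_nat.
Qed.

Lemma is_ideal_self : is_ideal A A.
Proof. by split => //; [apply: subring0 | apply: subringD]. Qed.

Lemma principal_is_ideal x : A x -> is_ideal A (principal A x).
Proof.
move=> Ax; split.
- by move=> _ [a Aa ->]; apply: AM.
- by exists 0; rewrite ?mulr0 //; apply: subring0.
- by move=> _ _ [a Aa ->] [b Ab ->]; exists (a + b);
    rewrite ?mulrDr //; apply: subringD.
- by move=> a _ Aa [b Ab ->]; exists (a * b); [apply: AM | rewrite mulrCA].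
Qed.

Lemma idealN I x : is_ideal A I -> I x -> I (- x).
Proof.
by case=> _ _ _ IM Ix; rewrite -mulN1r; apply: IM => //; apply: subringN.
Qed.

Lemma idealB I x y : is_ideal A I -> I x -> I y -> I (x - y).
Proof.
by move=> idI Ix Iy; case: (idI) => _ _ ID _; apply: ID => //; apply: idealN.
Qed.

Lemma idealMr I a x : is_ideal A I -> A a -> I x -> I (x * a).
Proof. by case=> _ _ _ IM Aa Ix; rewrite mulrC; apply: IM. Qed.

Lemma ideal_mul_is_ideal I J :
  is_ideal A I -> J `<=` A -> is_ideal A (ideal_mul I J).
Proof.
case=> IA I0 ID IM JA; split; [|exact: ideal_mul0|exact: ideal_mulD|].
  apply: ideal_mul_subset subring0 subringD _ => x y Ix Jy.
  by apply: AM; [apply: IA | apply: JA].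
move=> a x Aa.
apply: (ideal_mul_subset (X := [set x | ideal_mul I J (a * x)])) => /=.
- by rewrite mulr0; apply: ideal_mul0.
- by move=> y z hy hz; rewrite mulrDr; apply: ideal_mulD.
- by move=> y z Iy Jz; rewrite mulrA; apply: mem_ideal_mul => //; apply: IM.
Qed.

Lemma ideal_exp_is_ideal I n : is_ideal A I -> is_ideal A (ideal_exp A I n).
Proof.
move=> idI; elim: n => [|n IHn]; first exact: is_ideal_self.
by apply: ideal_mul_is_ideal => //; case: IHn.
Qed.

Lemma ideal_mul_subl I J : is_ideal A I -> J `<=` A -> ideal_mul I J `<=` I.
Proof.
move=> idI JA; case: (idI) => _ I0 ID _; apply: ideal_mul_subset => // x y Ix Jy.
by apply: idealMr => //; apply: JA.
Qed.

Lemma principal_mul b J :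
  A b -> is_ideal A J -> ideal_mul (principal A b) J = [set b * x | x in J].
Proof.
move=> Ab [JA J0 JD JM]; apply/seteqP; split.
  apply: ideal_mul_subset.
  - by exists 0; rewrite ?mulr0.
  - by move=> _ _ [x Jx <-] [y Jy <-]; exists (x + y);
      rewrite ?mulrDr //; apply: JD.
  - by move=> _ y [a Aa ->] Jy; exists (a * y); rewrite ?mulrA //; apply: JM.
move=> _ [x Jx <-]; apply: mem_ideal_mul => //.
by exists 1; rewrite ?mulr1.
Qed.

Lemma ideal_expD I n p : is_ideal A I ->
  ideal_exp A I (n + p) = ideal_mul (ideal_exp A I n) (ideal_exp A I p).
Proof.
move=> idI; elim: n => [|n IHn]; last first.
  by rewrite addSn /ideal_exp !iterS -/(ideal_exp A I _) IHn ideal_mulA.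
have -> : ideal_exp A I 0 = principal A 1.
  by apply/seteqP; split=> [x Ax|x [a Aa ->]]; [exists x | ]; rewrite ?mul1r.
rewrite principal_mul //; last exact: ideal_exp_is_ideal.
by apply/seteqP; split=> [x Ix|_ [x Ix <-]]; [exists x | ]; rewrite ?mul1r.
Qed.

Lemma mem_ideal_exp I x n : I x -> ideal_exp A I n (x ^+ n).
Proof.
by move=> Ix; elim: n => [|n IHn]; rewrite ?exprS //; apply: mem_ideal_mul.
Qed.

(** A product of [n] factors from [I] and [n] factors from [J] can be regrouped
    into [n] elements of [I J], whence the power of the generator of [I J]. *)
Lemma ideal_exp_mul_principal I J c x y n :
  A c -> ideal_mul I J `<=` principal A c ->
  ideal_exp A I n x -> ideal_exp A J n y -> principal A (c ^+ n) (x * y).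
Proof.
move=> Ac IJc; elim: n x y => [|n IHn] x y.
  by move=> Ax Ay; exists (x * y); rewrite ?mul1r //; apply: AM.
have [_ c0 cD _] := principal_is_ideal (subringX n.+1 Ac).
move=> Ix Jy; move: x Ix; apply: ideal_mul_subset.
- by rewrite mul0r.
- by move=> x x' hx hx'; rewrite mulrDl; apply: cD.
move=> u x Iu Ix; move: y Jy; apply: ideal_mul_subset.
- by rewrite mulr0.
- by move=> y y' hy hy'; rewrite mulrDr; apply: cD.
move=> v y Jv Jy.
have [a Aa e1] : principal A c (u * v) by apply: IJc; apply: mem_ideal_mul.
have [b Ab e2] := IHn _ _ Ix Jy.
exists (a * b); first exact: AM.
by rewrite mulrACA e1 e2 exprS mulrACA.
Qed.

Lemma prime_ideal_exp I x n : prime_ideal A I -> A x -> I (x ^+ n) -> I x.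
Proof.
move=> [idI I1 Iprime] Ax; elim: n => [|n IHn] //; rewrite exprS.
by case/Iprime => //; apply: subringX.
Qed.

(** Let [I^m = bA] and [a = q m + r] with [r < m]. Dividing [I^a = xA] by [b^q]
    shows that [I^r] is principal, and minimality of [m] forces
    [r = 0]. *)
Lemma principal_exp_generator I m b a x :
  is_ideal A I -> class_order A I m -> A b -> b != 0 ->
  ideal_exp A I m = principal A b ->
  A x -> ideal_exp A I a = principal A x ->
  exists q, associated A x (b ^+ q).
Proof.
move=> idI [m_gt0 _ m_min] Ab b0 Imb Ax Iax.
have split_exp j r : ideal_exp A I (j * m + r) =
    [set b ^+ j * y | y in ideal_exp A I r].
  elim: j => [|j IHj].
    by apply/seteqP; split=> [y Iy|_ [y Iy <-]]; [exists y | ]; rewrite ?mul1r.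
  rewrite mulSn -addnA ideal_expD // Imb principal_mul //; last first.
    exact: ideal_exp_is_ideal.
  rewrite IHj; apply/seteqP; split=> [_ [_ [y Iy <-] <-]|_ [y Iy <-]].
    by exists y; rewrite // exprS mulrA.
  by exists (b ^+ j * y); [exists y | rewrite exprS mulrA].
set q := (a %/ m)%N; set r := (a %% m)%N.
have bq0 : b ^+ q != 0 by rewrite expf_neq0.
have Ia := split_exp q r; rewrite -divn_eq in Ia.
have [p Ip xE] : [set b ^+ q * y | y in ideal_exp A I r] x.
  by rewrite -Ia Iax; exists 1; rewrite ?mulr1.
have [IrA _ _ IrM] := ideal_exp_is_ideal r idI.
have Irp : ideal_exp A I r = principal A p.
  apply/seteqP; split=> [z Iz|_ [z Az ->]]; last by rewrite mulrC; apply: IrM.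
  have [z' Az' e] : principal A x (b ^+ q * z) by rewrite -Iax Ia; exists z.
  by exists z' => //; apply: (mulfI bq0); rewrite e -xE mulrA.
have r0 : r = 0%N.
  apply/eqP; rewrite -leqn0 leqNgt; apply/negP => r_gt0.
  have := m_min r r_gt0; rewrite leqNgt ltn_mod m_gt0 => h.
  by suff: false by []; apply: h; exists p => //; apply: IrA.
exists q; split; first by rewrite -xE mulrC mulKf //; apply: IrA.
have [v Av e] : principal A p 1 by rewrite -Irp r0.
by exists v; rewrite // -xE (mulrC _ p) mulfK.
Qed.

End Subring.

End IdealProducts.
(** * Orders of prime conductor in a quadratic ring *)

Section PrimeConductor.

Lemma prime_bezout (R : nzRingType) (f : nat) (a : int) :
  prime f -> ~~ (f %| a)%Z ->
  exists u v : int, u%:~R * a%:~R + v%:~R * f%:R = 1 :> R.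
Proof.
move=> f_prime fNa; have [u [v uv]] := Bezoutz a f.
exists u, v; rewrite [f%:R]pmulrn -!intrM -intrD uv.
suff /eqP -> : coprimez a f by [].
by rewrite coprimezE coprime_sym prime_coprime.
Qed.

Lemma prime_dvdzM (f : nat) (a b : int) :
  prime f -> (f %| a * b)%Z -> (f %| a)%Z || (f %| b)%Z.
Proof. by move=> f_prime; rewrite !dvdzE abszM Euclid_dvdM. Qed.

(** What the arithmetic of the maximal order takes from its integral basis:
    conjugation is a ring involution with integral traces and norms. *)
Record quadratic_ring (K : fieldExtType rat) (D : set K) (sigma : K -> K) :
    Prop := QuadraticRing {
  qring1 : D 1;
  qringB : forall x y, D x -> D y -> D (x - y);
  qringM : forall x y, D x -> D y -> D (x * y);
  qring_trace : forall x, D x -> exists t : int, sigma x = t%:~R - x;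
  qring_norm : forall x, D x -> exists n : int, x * sigma x = n%:~R;
  conjM : forall x y, D x -> D y -> sigma (x * y) = sigma x * sigma y;
  conjK : forall x, D x -> sigma (sigma x) = x;
  conj_int : forall a : int, sigma a%:~R = a%:~R
}.

Variables (K : fieldExtType rat) (D : set K) (sigma : K -> K) (f : nat).
Hypotheses (Dq : quadratic_ring D sigma) (f_prime : prime f).

Let D1 : D 1 := qring1 Dq.
Let DB x y : D x -> D y -> D (x - y) := @qringB _ _ _ Dq x y.
Let DM x y : D x -> D y -> D (x * y) := @qringM _ _ _ Dq x y.
Let D0 : D 0 := subring0 D1 DB.
Let DD x y : D x -> D y -> D (x + y) := @subringD _ _ D1 DB x y.
Let DX x n : D x -> D (x ^+ n) := @subringX _ _ D1 DM x n.
Let Dnat n : D n%:R := subring_nat D1 DB n.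
Let Dint (a : int) : D a%:~R := subring_int D1 DB a.

Let conjDK x : D x -> sigma (sigma x) = x := @conjK _ _ _ Dq x.

(** [Z + fD], which for [D = Z[omega]] is [Z[f omega]]. *)
Definition order_of : set K :=
  [set x | exists a : int, exists2 y, D y & x = a%:~R + f%:R * y].

Local Notation O := order_of.
Local Notation F := (principal D f%:R).

Lemma intr_fieldExt_inj : injective (fun a : int => a%:~R : K).
Proof.
move=> a b /eqP; rewrite -subr_eq0 -intrB => /eqP e.
apply/eqP; rewrite -subr_eq0; apply/eqP.
have : ((a - b)%:~R : rat)%:A == 0 :> K by rewrite scaler_int e.
by rewrite scaler_eq0 oner_eq0 orbF intr_eq0 => /eqP.
Qed.

Lemma prime_nat_neq0 : f%:R != 0 :> K.
Proof.
rewrite pmulrn -[0]/(0%:~R); apply/eqP => /intr_fieldExt_inj /eqP.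
by rewrite eqz_nat -leqn0 leqNgt prime_gt0.
Qed.

Let f0 := prime_nat_neq0.

Lemma conjD_mem x : D x -> D (sigma x).
Proof. by move=> Dx; have [t ->] := qring_trace Dq Dx; apply: DB. Qed.


Lemma conj_nat n : sigma n%:R = n%:R.
Proof. by rewrite pmulrn; exact: (conj_int Dq). Qed.

Lemma conjX x n : D x -> sigma (x ^+ n) = sigma x ^+ n.
Proof.
move=> Dx; elim: n => [|n IHn]; first exact: (conj_nat 1).
by rewrite !exprS (conjM Dq) ?IHn //; apply: DX.
Qed.

(** Taking norms in [f z = 1] makes [f] invertible in the integers. *)
Lemma prime_nat_nunit : ~ F 1.
Proof.
move=> [z Dz e]; have [n en] := qring_norm Dq Dz.
have e2 : (f%:Z * (f%:Z * n))%:~R = (1%:Z)%:~R :> K.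
  have : f%:R * sigma z = 1.
    by rewrite -{1}(conj_nat f) -(conjM Dq) // -e (conj_nat 1).
  move=> e3; rewrite !intrM -pmulrn -en.
  transitivity ((f%:R * z) * (f%:R * sigma z)); first by ring.
  by rewrite -e e3 mulr1.
have /(congr1 absz) := intr_fieldExt_inj e2; rewrite abszM /= => /eqP.
by rewrite muln_eq1 => /andP[/eqP f1]; have := f_prime; rewrite f1.
Qed.

(** An integer prime to [f] in [I] would put [1] in [I] by Bezout. *)
Lemma ideal_int_dvd I (a : int) :
  is_ideal D I -> ~ I 1 -> I f%:R -> I a%:~R -> (f %| a)%Z.
Proof.
move=> [_ _ ID IM] I1 If Ia; apply/negPn/negP => fNa; apply: I1.
have [u [v <-]] := prime_bezout K f_prime fNa.
by apply: ID; apply: IM.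
Qed.

Lemma mem_principal_int (a : int) : (f %| a)%Z -> F a%:~R.
Proof.
case/dvdzP => b ->; exists b%:~R => //.
by rewrite intrM -pmulrn mulrC.
Qed.

Lemma principal_prime_is_ideal : is_ideal D F.
Proof. exact: principal_is_ideal. Qed.

Lemma order_sub : O `<=` D.
Proof. by move=> _ [a [y Dy ->]]; apply: DD => //; apply: DM. Qed.

Lemma principal_sub_order : F `<=` O.
Proof. by move=> _ [y Dy ->]; exists 0, y; rewrite ?add0r. Qed.

Lemma order_int (a : int) : O a%:~R.
Proof. by exists a, 0; rewrite ?mulr0 ?addr0. Qed.

Lemma order1 : O 1. Proof. exact: (order_int 1). Qed.

Lemma orderB x y : O x -> O y -> O (x - y).
Proof.
move=> [a [z Dz ->]] [a' [z' Dz' ->]].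
by exists (a - a'), (z - z'); [apply: DB | rewrite intrB; ring].
Qed.

Lemma orderM x y : O x -> O y -> O (x * y).
Proof.
move=> [a [z Dz ->]] [a' [z' Dz' ->]].
exists (a * a'), (a%:~R * z' + z * a'%:~R + f%:R * (z * z')).
  by do ![apply: DD | apply: DM | done].
by rewrite intrM; ring.
Qed.

Lemma order_conj x : O x -> O (sigma x).
Proof.
move=> Ox; have [t ->] := qring_trace Dq (order_sub Ox).
by apply: orderB => //; apply: order_int.
Qed.

(** Modulo [F], an element [a + f z] of [O] is the integer [a]. *)
Lemma principal_prime x y : O x -> O y -> F (x * y) -> F x \/ F y.
Proof.
have [FD F0 Fadd FM] := principal_prime_is_ideal.
move=> [a [z Dz ->]] [b [w Dw ->]] Fxy.
have : (f %| a * b)%Z.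
  apply: (ideal_int_dvd principal_prime_is_ideal prime_nat_nunit).
    by exists 1; rewrite ?mulr1.
  have -> : (a * b)%:~R = (a%:~R + f%:R * z) * (b%:~R + f%:R * w)
     - f%:R * (a%:~R * w + z * b%:~R + f%:R * (z * w)) by rewrite intrM; ring.
  apply: (idealB D1 DB principal_prime_is_ideal) => //; eexists; last reflexivity.
  by do ![apply: DD | apply: DM | done].
case/(prime_dvdzM f_prime)/orP=> /mem_principal_int Fa; [left | right].
  by apply: Fadd => //; exists z.
by apply: Fadd => //; exists w.
Qed.

(** If [x = a + f y] multiplies [D] into [O] with [f] prime to [a], then so
    does [a], hence so does [1 = u a + v f]. *)
Lemma conductorE : ~ (D `<=` O) -> conductor D O = F.
Proof.
move=> DnO; apply/seteqP; split=> [x [Ox xDO]|_ [y Dy ->]]; last first.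
  split=> [|z Dz]; first by apply: principal_sub_order; exists y.
  by rewrite -mulrA; apply: principal_sub_order; exists (y * z) => //; apply: DM.
move: Ox xDO => [a [y Dy ->]] xDO.
have [_ _ Fadd _] := principal_prime_is_ideal.
have [/mem_principal_int Fa|fNa] := boolP (f %| a)%Z.
  by apply: Fadd => //; exists y.
case: DnO => z Dz; have [u [v uv]] := prime_bezout K f_prime fNa.
have -> : z = u%:~R * ((a%:~R + f%:R * y) * z) -
  f%:R * (u%:~R * y * z - v%:~R * z).
  by rewrite -[LHS]mul1r -[X in X * _ = _]uv; ring.
apply: orderB; first by apply: orderM; [apply: order_int | apply: xDO].
by apply: principal_sub_order; eexists; last reflexivity;
  
  do ![apply: DB | apply: DM | done].
Qed.

(** The norm of [y] is an integer of [yO]; it is prime to [f] because [F] is a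
    prime ideal stable under conjugation. *)
Lemma order_norm_nprincipal y : O y -> ~ F y ->
  exists2 z, O z & exists2 n : int, y * z = n%:~R & ~~ (f %| n)%Z.
Proof.
move=> Oy Fy; exists (sigma y); first exact: order_conj.
have [n en] := qring_norm Dq (order_sub Oy).
exists n => //; apply/negP => /mem_principal_int; rewrite -en.
case/(principal_prime Oy (order_conj Oy)) => // -[z Dz ez]; apply: Fy.
rewrite -(conjK Dq (order_sub Oy)) ez (conjM Dq) // conj_nat.
by exists (sigma z) => //; apply: conjD_mem.
Qed.

Lemma principal_sqr_sub x : ideal_exp O F 2 x -> principal D (f%:R ^+ 2) x.
Proof.
have [_ X0 XD XM] := principal_is_ideal D1 DB DM (DX 2 (Dnat f)).
move: x; apply: (ideal_mul_subset X0 XD) => _ y [z Dz ->] FOy.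
suff [w Dw ->] : F y.
  by exists (z * w); [apply: DM | rewrite mulrACA].
have [_ F0 FD FM] := principal_prime_is_ideal.
move: y FOy; apply: (ideal_mul_subset F0 FD) => a b Fa Ob.
by rewrite mulrC; apply: FM => //; apply: order_sub.
Qed.

Lemma principal_sqr_mem y : D y -> ideal_exp O F 2 (f%:R ^+ 2 * y).
Proof.
move=> Dy; rewrite expr2 -mulrA; apply: mem_ideal_mul.
  by exists 1; rewrite ?mulr1.
rewrite -[_ * y]mulr1; apply: mem_ideal_mul; first by exists y.
exact: order1.
Qed.

(** Modulo the conductor [F = fD], the maximal ideal of [O] above [f], an
    [F]-primary principal ideal is one containing a power of [f]; it is generated
    by some [f g], and [f g] lies in [F^2 = f^2 D] exactly when [f] divides [g].
    Maximality of [F] is used in the form: an element of [O] outside [F] divides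
    an integer prime to [f]. *)
Lemma basic_elementE t : O t ->
  basic_element O F t <->
  exists g, [/\ D g, t = f%:R * g, ~ F g &
    exists k, principal D g (f%:R ^+ k)].
Proof.
move=> Ot; split.
  move=> [_ [[[tO _ _ _] t1 _] radt tF2]].
  have [g Dg tE] : F t.
    by rewrite -radt; split=> //; exists 1%N => //; exists 1;
      rewrite ?mulr1 //; apply: order1.
  exists g; split=> //.
    move=> [h Dh gE]; apply: tF2 => _ [o Oo ->].
    rewrite tE gE mulrA -expr2 -mulrA; apply: principal_sqr_mem.
    by apply: DM => //; apply: order_sub.
  have : F f%:R by exists 1; rewrite ?mulr1.
  rewrite -radt => -[_ [[//|n] _ [o Oo fE]]].
  exists n, o; first exact: order_sub.
  by apply: (mulfI f0); rewrite -exprS fE tE mulrA.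
move=> [g [Dg tE Fg [k [g' Dg' fkE]]]].
(* If [f^k = g g'], then [f^(k+1) = t g']; one more factor [f] is needed because
   [f g'] lies in [O] while [g'] need not. *)
have fkt : principal O t (f%:R ^+ k.+2).
  exists (f%:R * g'); first by apply: principal_sub_order; exists g'.
  by rewrite 2!exprS fkE tE; ring.
have ft : forall x, principal O t x -> F x.
  move=> _ [o Oo ->]; rewrite tE -mulrA; exists (g * o) => //.
  by apply: DM => //; apply: order_sub.
have [tsub t0 tD tM] := principal_is_ideal order1 orderB orderM Ot.
have F_rad x : F x -> principal O t (x ^+ k.+2).
  move=> [y Dy ->]; exists (f%:R * (g' * y ^+ k.+2)).
    by apply: principal_sub_order; exists (g' * y ^+ k.+2) => //;
      apply: DM => //; apply: DX.
  by rewrite exprMn [f%:R ^+ _]exprS exprS fkE tE; ring.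
split=> //; split.
- split; first by split.
    by move/ft/prime_nat_nunit.
  move=> x y Ox Oy txy; have [Fy|Fy] := pselect (F y).
    by right; exists k.+2 => //; apply: F_rad.
  left; have [z Oz [n en fNn]] := order_norm_nprincipal Oy Fy.
  have [u [v uv]] : exists u v : int,
      u%:~R * n%:~R + v%:~R * f%:R ^+ k.+2 = 1 :> K.
    have [u [v]] := Bezoutz n (f%:Z ^+ k.+2).
    have /eqP -> : coprimez n (f%:Z ^+ k.+2).
      by apply: coprimezXr; rewrite coprimezE coprime_sym prime_coprime.
    move=> e; exists u, v; rewrite -[RHS]/(1%:~R) -e intrD.
    by rewrite (intrM _ u) (intrM _ v) rmorphXn.
  have -> : x = (u%:~R * z) * (x * y) + (v%:~R * x) * f%:R ^+ k.+2.
    by rewrite -[LHS]mulr1 -[X in _ * X = _]uv -en; ring.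
  by apply: tD; apply: tM => //; apply: orderM => //; apply: order_int.
- apply/seteqP; split=> [x [Ox [n n_gt0 /ft]]|x Fx]; last first.
    by split; [apply: principal_sub_order | exists k.+2 => //; apply: F_rad].
  elim: n {n_gt0} => [/prime_nat_nunit //|n IHn]; rewrite exprS.
  by case/principal_prime => //; apply: (subringX order1 orderM).
move=> tF2; have : principal O t t by exists 1; rewrite ?mulr1 //; apply: order1.
move=> /tF2/principal_sqr_sub [h Dh e]; apply: Fg.
by exists h => //; apply: (mulfI f0); rewrite -tE e expr2 mulrA.
Qed.

(** If [u v = 1], then [u' v' = 1] for the conjugates, so [v = u' (v v')] where
    [v v'] is an integer. *)
Lemma units_order u : units D u -> O u -> units O u.
Proof.
move=> [Du [v Dv uv]] Ou; split=> //; exists v => //.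
have [n en] := qring_norm Dq Du; have [n' en'] := qring_norm Dq Dv.
suff -> : v = sigma u * n'%:~R.
  by apply: orderM; [apply: order_conj | apply: order_int].
have e : sigma u * sigma v = 1 by rewrite -(conjM Dq) // uv (conj_nat 1).
by rewrite -en' mulrCA e mulr1.
Qed.

(** One of the norm [x x'] and the trace [x + x'] is prime to [f] when [x] is
    outside [Q]: if [f] divides the norm, then [x'] lies in [Q] and the trace
    does not. In both cases an integer prime to [f] lies in [xD + Q]. *)
Lemma prime_ideal_comaximal Q x :
  prime_ideal D Q -> Q f%:R -> D x -> ~ Q x -> exists2 a, D a & Q (1 - x * a).
Proof.
move=> [[QD Q0 QA QM] Q1 Qprime] Qf Dx Qx.
have [n en] := qring_norm Dq Dx.
have FQ y : F y -> Q y by move=> [z Dz ->]; rewrite mulrC; apply: QM.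
have Dsx := conjD_mem Dx.
have [fn|fNn] := boolP (f %| n)%Z; last first.
  have [u [v uv]] := prime_bezout K f_prime fNn.
  exists (u%:~R * sigma x); first exact: DM.
  rewrite mulrCA en -[X in Q (X - _)]uv addrAC subrr add0r.
  exact: QM.
have Qsx : Q (sigma x).
  by have := FQ _ (mem_principal_int fn); rewrite -en => /Qprime[].
have [t et] := qring_trace Dq Dx.
have tE : x = t%:~R - sigma x by rewrite et; ring.
have fNt : ~~ (f %| t)%Z.
  apply/negP => /mem_principal_int/FQ Qt; apply: Qx; rewrite tE.
  by apply: (idealB D1 DB).
have [u [v uv]] := prime_bezout K f_prime fNt.
exists u%:~R => //.
have -> : 1 - x * u%:~R = u%:~R * sigma x + v%:~R * f%:R.
  by rewrite -[X in X - _]uv {1}tE; ring.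
by apply: QA; apply: QM.
Qed.

(** Raise the relation [1 - x a] in [Q] to the power [n]. *)
Lemma prime_exp_comaximal Q x n :
  prime_ideal D Q -> Q f%:R -> D x -> ~ Q x ->
  exists2 a, D a & ideal_exp D Q n (1 - x * a).
Proof.
move=> Qp Qf Dx Qx; have [a Da Qa] := prime_ideal_comaximal Qp Qf Dx Qx.
suff [b Db e] : exists2 b, D b & (1 - x * a) ^+ n = 1 - x * b.
  by exists b => //; rewrite -e; apply: mem_ideal_exp.
elim: n => [|n [b Db IHn]]; first by exists 0; rewrite ?mulr0 ?subr0.
exists (a + b - x * a * b); last by rewrite exprS IHn; ring.
by do ![apply: DB | apply: DD | apply: DM | done].
Qed.

(** Let [N(x) = +- f^a]. The elements [x] and [x'] are invertible modulo [Q^a]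
    and [P^a] respectively, so that [P^a] is contained in [xD + P^a Q^a] and
    [x] in [x x' D + P^a]; here [P^a Q^a] and [x x' D] both lie in [f^a D], which
    is contained in [xD] and in [P^a]. *)
Lemma prime_power_of_dvd P Q x k :
  prime_ideal D P -> prime_ideal D Q -> Q = sigma @` P ->
  P f%:R -> Q f%:R -> ideal_mul P Q `<=` F ->
  D x -> principal D x (f%:R ^+ k) -> ~ Q x ->
  exists a, ideal_exp D P a = principal D x.
Proof.
move=> Pp Qp QE Pf Qf PQ Dx [y Dy xy] Qx.
have [n en] := qring_norm Dq Dx; have [n' en'] := qring_norm Dq Dy.
have fnn : (f ^ (k + k))%N%:Z = n * n'.
  apply: intr_fieldExt_inj; rewrite intrM -en -en' mulrACA -xy -(conjM Dq) // -xy.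
  by rewrite conjX // conj_nat -pmulrn natrX exprD.
have /(dvdn_pfactor _ _ f_prime) [a _ na] : (`|n| %| f ^ (k + k))%N.
  by rewrite -[X in (_ %| X)%N]/(`|(f ^ (k + k))%N%:Z|%N) fnn abszM dvdn_mulr.
set e : int := (-1) ^+ (n < 0)%R.
have nE : n%:~R = e%:~R * f%:R ^+ a :> K.
  by rewrite {1}[n]intEsign -/e na intrM -[X in _ * X = _]pmulrn natrX.
have Psx : ~ P (sigma x).
  move=> Psx; apply: Qx; rewrite QE; exists (sigma x) => //; exact: conjDK.
have [Pi _ _] := Pp.
have [PaD _ PaA PaM] := ideal_exp_is_ideal D1 DB DM a Pi.
exists a; apply/seteqP; split=> [p Pap|_ [z Dz ->]].
  have [b Db Qab] := prime_exp_comaximal a Qp Qf Dx Qx.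
  have [c Dc ec] := ideal_exp_mul_principal D1 DB DM (Dnat f) PQ Pap Qab.
  exists (p * b + sigma x * e%:~R * c).
    have Dsx : D (sigma x) := conjD_mem Dx; have Dp : D p := PaD _ Pap.
    by do ![apply: DD | apply: DM | done].
  have fa : f%:R ^+ a = e%:~R * (x * sigma x).
    by rewrite en nE mulrA -intrM /e -expr2 sqrr_sign mul1r.
  transitivity (x * (p * b) + p * (1 - x * b)); first by ring.
  by rewrite ec fa; ring.
have [b Db Pab] := prime_exp_comaximal a Pp Pf (conjD_mem Dx) Psx.
have -> : x * z = z * (e%:~R * b * f%:R ^+ a + x * (1 - sigma x * b)).
  have -> : x * (1 - sigma x * b) = x - x * sigma x * b by ring.
  by rewrite en nE; ring.
apply: (PaM) => //; apply: PaA; apply: PaM => //; last exact: mem_ideal_exp.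
by apply: DM.
Qed.

(** * The case where the conductor splits *)

Section SplitPrime.

Variables (P Q : set K) (m : nat) (beta : K).
Hypotheses (Pp : prime_ideal D P) (Qp : prime_ideal D Q).
Hypotheses (QE : Q = sigma @` P) (PnQ : P <> Q) (FE : F = ideal_mul P Q).
Hypotheses (Pm : class_order D P m) (Dbeta : D beta).
Hypothesis Pbeta : ideal_exp D P m = principal D beta.

Let Pi : is_ideal D P. Proof. by case: Pp. Qed.
Let Qi : is_ideal D Q. Proof. by case: Qp. Qed.
Let PD : P `<=` D. Proof. by case: Pi. Qed.
Let QD : Q `<=` D. Proof. by case: Qi. Qed.

Let FP : F `<=` P.
Proof. by rewrite FE; apply: ideal_mul_subl Pi QD. Qed.

Let FQ : F `<=` Q.
Proof. by rewrite FE ideal_mulC; apply: ideal_mul_subl Qi PD. Qed.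

Let Ff : F f%:R. Proof. by exists 1; rewrite ?mulr1. Qed.

(** Conjugation is an involution, so [P] contained in [Q] would also give the
    reverse inclusion. *)
Lemma prime_nsub_conj : ~ (P `<=` Q).
Proof.
move=> sub; apply: PnQ; apply/seteqP; split=> // x.
rewrite QE => -[p /sub + <-]; rewrite {1}QE => -[p' Pp' <-].
by rewrite conjDK //; apply: PD.
Qed.

(** On [O = Z + F], membership in [R] only concerns the integral part, which
    [f] has to divide. *)
Lemma order_prime_sub R : prime_ideal D R -> F `<=` R -> R `&` O `<=` F.
Proof.
move=> [Ri R1 _] FR _ [/[swap] -[a [y Dy ->]] Ray].
have [_ _ FA _] := principal_prime_is_ideal.
apply: FA; last by exists y.
apply: mem_principal_int; apply: (ideal_int_dvd Ri R1); first exact: FR.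
rewrite -[X in R X](addrK (f%:R * y)); apply: (idealB D1 DB) => //.
by apply: FR; exists y.
Qed.

(** If [D] were contained in [O], then [P] would be contained in [F], hence
    in [Q]. *)
Lemma order_proper : ~ (D `<=` O).
Proof.
move=> DO; apply: prime_nsub_conj => x Px.
by apply/FQ/(order_prime_sub Pp FP); split=> //; apply/DO/PD.
Qed.

(** [P] and [Q] are comaximal, so their intersection is their product. *)
Lemma prime_ideal_capE x : P x -> Q x -> F x.
Proof.
move=> Px Qx.
have [z Pz Qz] : exists2 z, P z & ~ Q z.
  apply: contrapT => h; apply: prime_nsub_conj => z Pz.
  by apply: contrapT => Qz; apply: h; exists z.
have [a Da Qa] := prime_ideal_comaximal Qp (FQ Ff) (PD Pz) Qz.
have [_ _ FA _] := principal_prime_is_ideal; rewrite FE in FA *.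
have -> : x = z * a * x + x * (1 - z * a) by ring.
apply: FA; apply: mem_ideal_mul => //.
by case: Pi => _ _ _ PM; rewrite mulrC; apply: PM.
Qed.

Let m_gt0 : (0 < m)%N. Proof. by case: Pm. Qed.

Lemma beta_mem : P beta.
Proof.
suff : ideal_exp D P m `<=` P by apply; rewrite Pbeta; exists 1; rewrite ?mulr1.
case: (m) m_gt0 => // n _; apply: (ideal_mul_subl Pi).
by case: (ideal_exp_is_ideal D1 DB DM n Pi).
Qed.

(** The [m]-th power of every element of [P] is a multiple of [beta]; with
    [beta] in [Q], this would force [P] into [Q]. *)
Lemma beta_nmem : ~ Q beta.
Proof.
move=> Qb; apply: prime_nsub_conj => x Px.
apply: (prime_ideal_exp (n := m) D1 DM Qp (PD Px)).
have : ideal_exp D P m (x ^+ m) by apply: mem_ideal_exp.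
by rewrite Pbeta => -[a Da ->]; rewrite mulrC; case: Qi => _ _ _; apply.
Qed.

Lemma beta_dvd : principal D beta (f%:R ^+ m).
Proof. by rewrite -Pbeta; apply: mem_ideal_exp => //; apply: FP Ff. Qed.

Let beta0 : beta != 0.
Proof. by apply/eqP => b0; apply: beta_nmem; rewrite b0; case: Qi. Qed.

Lemma associated_conj x y : associated D x y -> D x -> D y -> y != 0 ->
  associated D (sigma x) (sigma y).
Proof.
move=> [Dxy [v Dv e]] Dx Dy y0.
have sy0 : sigma y != 0.
  apply: contra_neq y0 => sy0; rewrite -(conjDK Dy) sy0; exact: (conj_nat 0).
rewrite /associated; have -> : sigma x / sigma y = sigma (x / y).
  by apply: (mulIf sy0); rewrite mulfVK // -(conjM Dq) // mulfVK.
split; first exact: conjD_mem.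
by exists (sigma v); [apply: conjD_mem | rewrite -(conjM Dq) // e (conj_nat 1)].
Qed.

(** An element [g] outside [F] avoids one of [P], [Q]. If it avoids [Q], then
    [gD] is a power of [P]; if it avoids [P], the same applies to its
    conjugate. *)
Lemma dvd_prime_power_associated g k :
  D g -> principal D g (f%:R ^+ k) -> ~ F g ->
  exists n, associated D g (beta ^+ n) \/ associated D g (sigma beta ^+ n).
Proof.
have FPQ : ideal_mul P Q `<=` F by rewrite FE.
have main x : D x -> principal D x (f%:R ^+ k) -> ~ Q x ->
    exists n, associated D x (beta ^+ n).
  move=> Dx xk Qx.
  have [a Pax] := prime_power_of_dvd Pp Qp QE (FP Ff) (FQ Ff) FPQ Dx xk Qx.
  exact: (principal_exp_generator D1 DB DM Pi Pm Dbeta beta0 Pbeta Dx Pax).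
move=> Dg gk Fg; have [Qg|Qg] := pselect (Q g); last first.
  by have [n] := main g Dg gk Qg; exists n; left.
have Pg : ~ P g by move=> Pg; apply: Fg; apply: prime_ideal_capE.
have [|||n] := main (sigma g).
- exact: conjD_mem.
- case: gk => g' Dg' e; exists (sigma g'); first exact: conjD_mem.
  by rewrite -(conjM Dq) // -e conjX // conj_nat.
- rewrite QE => -[p Pp' /(congr1 sigma)]; rewrite !conjDK //; last exact: PD.
  by move=> e; rewrite e in Pp'.
move=> asn; exists n; right; rewrite -conjX // -[g]conjDK //.
by apply: associated_conj => //;
  [apply: conjD_mem | apply: DX | rewrite expf_neq0].
Qed.

(** Conjugation exchanges [(P, beta)] and [(Q, beta')]. The Boolean index of
    [gen] and [gen_prime] treats the two families [t_n] and [t_n'] at once: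
    [gen b] lies in [gen_prime b] but not in [gen_prime (~~ b)]. *)
Definition gen (b : bool) : K := if b then sigma beta else beta.
Definition gen_prime (b : bool) : set K := if b then Q else P.

Lemma gen_primeP b : prime_ideal D (gen_prime b).
Proof. by case: b. Qed.

Lemma principal_sub_gen_prime b : F `<=` gen_prime b.
Proof. by case: b. Qed.

Lemma gen_mem b : gen_prime b (gen b).
Proof. by case: b => /=; [rewrite QE; exists beta => // | ]; apply: beta_mem. Qed.

Lemma genD b : D (gen b).
Proof. by case: b => //; apply: conjD_mem. Qed.

Lemma gen_nmem b : ~ gen_prime (~~ b) (gen b).
Proof.
case: b => /=; last exact: beta_nmem.
move=> Pb; apply: beta_nmem; rewrite QE; exists (sigma beta) => //.
exact: conjDK.
Qed.

Lemma gen_dvd b : principal D (gen b) (f%:R ^+ m).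
Proof.
have [c Dc e] := beta_dvd; case: b; last by exists c.
exists (sigma c); first exact: conjD_mem.
by rewrite -(conjM Dq) // -e conjX // conj_nat.
Qed.

Lemma gen_neq0 b : gen b != 0.
Proof.
apply/eqP => b0; apply: (@gen_nmem b); rewrite b0.
by case: (gen_primeP (~~ b)) => -[].
Qed.

Lemma genX_unit_nmem b n w : units D w -> ~ gen_prime (~~ b) (gen b ^+ n * w).
Proof.
move=> [Dw [v Dv wv]] h; apply: (@gen_nmem b).
apply: (prime_ideal_exp (n := n) D1 DM (gen_primeP _) (genD b)).
case: (gen_primeP (~~ b)) => -[_ _ _ RM] _ _.
by rewrite -[_ ^+ _]mulr1 -wv mulrA mulrC; apply: RM.
Qed.

Lemma genX_mem b n x : (0 < n)%N -> D x -> gen_prime b (gen b ^+ n * x).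
Proof.
case: n => // n _ Dx; case: (gen_primeP b) => -[_ _ _ RM] _ _.
rewrite exprSr mulrAC; apply: RM; last exact: gen_mem.
by apply: DM => //; apply: DX; apply: genD.
Qed.

Lemma unit_nmem b w : units D w -> ~ gen_prime b w.
Proof.
by move=> uw; have := @genX_unit_nmem (~~ b) 0 w uw; rewrite mul1r negbK.
Qed.

Lemma associated_mul x y : y != 0 -> associated D x y ->
  exists2 u, units D u & x = y * u.
Proof. by move=> y0 uxy; exists (x / y) => //; rewrite mulrCA mulfV // mulr1. Qed.

Lemma basic_element_gen t : O t ->
  basic_element O F t <->
  exists n, associated D t (f%:R * gen false ^+ n) \/
            associated D t (f%:R * gen true ^+ n).
Proof.
move=> Ot; rewrite basic_elementE //; split.
  move=> [g [Dg -> Fg [k gk]]].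
  have [n asn] := dvd_prime_power_associated Dg gk Fg.
  by exists n; case: asn => asn; [left | right];
    rewrite /associated -mulf_div mulfV // mul1r.
move=> [n asn].
have [b {}asn] : exists b, associated D t (f%:R * gen b ^+ n).
  by case: asn; [exists false | exists true].
have [|u uu tE] := associated_mul _ asn.
  by rewrite mulf_neq0 // expf_neq0 // gen_neq0.
exists (gen b ^+ n * u); split; last 1 first.
- have [c Dc e] := gen_dvd b; case: (uu) => Du [v Dv uv].
  exists (m * n)%N, (c ^+ n * v); first by apply: DM => //; apply: DX.
  by rewrite exprM e exprMn mulrACA uv mulr1.
- by case: uu => Du _; apply: DM => //; apply/DX/genD.
- by rewrite tE mulrA.
- by move/(@principal_sub_gen_prime (~~ b)); apply: genX_unit_nmem.
Qed.

(** Cancelling [f], an inclusion says [gen b ^ n w = gen b' ^ n' w' o] with [o] in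
    [O]. For [b <> b'] the right-hand side lies in a prime avoided by the left-hand
    side. For [b = b'] and [n < n'] the unit [w] would lie in [gen_prime b]; for
    [n > n'] the factor [o], being in [O] and in [gen_prime b], would lie in [F] and
    hence in the other prime. What remains is [w / w' = o]. *)
Lemma gen_ideal_sub b b' n n' w w' : (0 < n)%N -> (0 < n')%N ->
  units D w -> units D w' ->
  principal O (f%:R * gen b ^+ n * w) `<=`
    principal O (f%:R * gen b' ^+ n' * w') ->
  [/\ b = b', n = n' & units O (w / w')].
Proof.
move=> n_gt0 n'_gt0 uw uw' sub.
have [o Oo /esym eo] :
    principal O (f%:R * gen b' ^+ n' * w') (f%:R * gen b ^+ n * w).
  by apply: sub; exists 1; rewrite ?mulr1 //; apply: order1.
have {eo} e : gen b ^+ n * w = gen b' ^+ n' * (w' * o).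
  by apply: (mulfI f0); rewrite !mulrA eo.
have Do := order_sub Oo.
have [Dw [v Dv wv]] := uw; have [Dw' [v' Dv' wv']] := uw'.
have [eb|] := eqVneq b' b; last first.
  rewrite -[b'](negbK) => bb; exfalso.
  apply: (@genX_unit_nmem b n w uw); rewrite e.
  have -> : ~~ b = b' by case: (b) (b') bb => -[].
  by apply: genX_mem => //; apply: DM.
rewrite eb in e *.
have w'0 : w' != 0.
  by apply: contra_eq_neq wv' => ->; rewrite mul0r eq_sym oner_eq0.
have [lt_nn'|lt_n'n|enn'] := ltngtP n n'.
- exfalso; apply: (@unit_nmem b w uw).
  have -> : w = gen b ^+ (n' - n) * (w' * o).
    apply: (mulfI (expf_neq0 n (gen_neq0 b))).
    by rewrite e [RHS]mulrA -exprD subnKC // ltnW.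
  by apply: genX_mem; rewrite ?subn_gt0 //; apply: DM.
- exfalso; have e' : gen b ^+ (n - n') * w = w' * o.
    apply: (mulfI (expf_neq0 n' (gen_neq0 b))).
    by rewrite [LHS]mulrA -exprD subnKC ?e // ltnW.
  have oE : o = gen b ^+ (n - n') * (w * v').
    by rewrite mulrA e' mulrAC wv' mul1r.
  have Fo : F o.
    apply: (order_prime_sub (gen_primeP b) (@principal_sub_gen_prime b)).
    by split=> //; rewrite oE; apply: genX_mem; rewrite ?subn_gt0 //; apply: DM.
  apply: (@genX_unit_nmem b (n - n') w uw); rewrite e'.
  case: (gen_primeP (~~ b)) => -[_ _ _ RM] _ _; apply: RM => //.
  exact: principal_sub_gen_prime.
split=> //; rewrite enn' in e.
have wE : w / w' = o.
  have /(mulfI (expf_neq0 _ (gen_neq0 b))) -> := e.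
  by rewrite mulrAC mulfV // mul1r.
apply: units_order; last by rewrite wE.
rewrite wE; split=> //; exists (w' * v); first exact: DM.
by rewrite -wE mulrA mulfVK.
Qed.

(** If [f^2 D] were contained in [f gen^n w O], then the quotient [o] of [f] by
    [gen^n w] would multiply [D] into [O], that is, [o] would lie in the conductor
    [fD]; dividing by [f] makes [gen b] a unit. *)
Lemma principal_sqr_nsub b n w : (0 < n)%N -> units D w ->
  ~ (ideal_exp O F 2 `<=` principal O (f%:R * gen b ^+ n * w)).
Proof.
move=> n_gt0 uw sub; have [Dw _] := uw.
have key y : D y -> exists2 o, O o & f%:R * y = gen b ^+ n * w * o.
  move=> Dy; have [o Oo e] := sub _ (principal_sqr_mem Dy).
  by exists o => //; apply: (mulfI f0); rewrite !mulrA -expr2 e.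
have [o Oo /esym eo] := key 1 D1; rewrite mulr1 in eo.
have w0 : w != 0.
  apply/eqP => w0; apply: (@unit_nmem b w uw); rewrite w0.
  by case: (gen_primeP b) => -[].
have [z Dz oE] : F o.
  rewrite -(conductorE order_proper); split=> // y Dy.
  have [o' Oo' e] := key y Dy.
  suff -> : o * y = o' by [].
  apply: (mulfI (mulf_neq0 (expf_neq0 n (gen_neq0 b)) w0)).
  by rewrite mulrA eo e.
have [_ R1 _] := gen_primeP b; apply: R1.
have -> : 1 = gen b ^+ n * (w * z).
  by apply: (mulfI f0); rewrite mulr1 -[LHS]eo oE; ring.
by apply: genX_mem => //; apply: DM.
Qed.

End SplitPrime.

End PrimeConductor.

(** * The ring of integers of a quadratic field *)

(** The quadratic equation reduces integral polynomials in [x] to degree 1. *)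
Lemma Zadjoin_quadratic (K : fieldType) (x : K) (t n : int) :
  x ^+ 2 = t%:~R * x - n%:~R ->
  Zadjoin x = [set y | exists a b : int, y = a%:~R + b%:~R * x].
Proof.
move=> x2; apply/seteqP; split=> [_ [p ->]|_ [a [b ->]]]; last first.
  exists (a%:P + b%:P * 'X).
  by rewrite rmorphD rmorphM /= !map_polyC /= map_polyX !hornerE.
elim/poly_ind: p => [|p c [a [b IHp]]].
  by exists 0, 0; rewrite rmorph0 horner0; ring.
exists (c - b * n), (a + b * t).
rewrite rmorphD rmorphM /= map_polyC /= map_polyX !hornerE IHp.
rewrite mulrDl -mulrA -expr2 x2.
by rewrite !rmorphD !rmorphM /= !rmorphN /= !rmorphM /=; ring.
Qed.

(** A rational square root of [d] has denominator 1, so [d = n^2] for an integer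
    [n], and square-freeness gives [n = +- 1]. *)
Lemma squarefree_not_square (d : int) (r : rat) :
  squarefree d -> d <> 1 -> r ^+ 2 <> d%:~R.
Proof.
move=> d_sqf d1 er; apply: d1.
have {er} e : numq r ^+ 2 = d * denq r ^+ 2.
  apply: (@intr_inj rat); rewrite rmorphXn rmorphM rmorphXn /= -er.
  by rewrite -exprMn {2}[r](esym (divq_num_den r)) mulfVK // intr_eq0 denq_neq0.
have d_r1 : `|denq r|%N = 1%N.
  apply/eqP; rewrite -dvdn1 -(@Gauss_dvdr _ (`|numq r| ^ 2)%N); last first.
    by rewrite coprimeXr // coprime_sym coprime_num_den.
  by rewrite muln1 -abszX e abszM abszX expnS dvdn_mull // dvdn_mulr.
have dE : `|d|%N = (`|numq r| ^ 2)%N.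
  by rewrite -abszX e abszM abszX d_r1 muln1.
have n1 : `|numq r|%N = 1%N by apply: d_sqf; rewrite dE.
have d_ge0 : 0 <= d.
  have := sqr_ge0 (numq r); rewrite e pmulr_lge0 // exprn_gt0 //.
by rewrite -[d]gez0_abs // dE n1.
Qed.

Section QuadraticField.

Variables (d : int) (K : fieldExtType rat) (s : K).
Hypotheses (d_sqf : squarefree d) (d1 : d <> 1) (s2 : s ^+ 2 = d%:~R).

Lemma sqrt_not_rat (r : rat) : s != r%:A.
Proof.
apply/eqP => e; apply: (@squarefree_not_square d r) => //.
have : (r ^+ 2 - d%:~R)%:A == 0 :> K.
  by rewrite scalerBl scaler_int -s2 e exprZn expr1n subrr.
by rewrite scaler_eq0 oner_eq0 orbF subr_eq0 => /eqP.
Qed.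

Lemma one_sqrt_free : free [tuple 1; s].
Proof.
rewrite /= free_cons seq1_free span_seq1; apply/andP; split; last first.
  by have := sqrt_not_rat 0; rewrite scale0r.
apply/vlineP => -[r e].
have r0 : r != 0 by apply: contra_eq_neq e => ->; rewrite scale0r oner_neq0.
by have /eqP := sqrt_not_rat r^-1; apply; rewrite e scalerA mulVf ?scale1r.
Qed.

Lemma qconjE (a b : rat) : qconj s (a%:A + b *: s) = a%:A - b *: s.
Proof.
rewrite /qconj !linearD !linearZ /=.
have c i j := coord_free i j one_sqrt_free.
have := c ord0 ord0; have := c ord0 ord_max.
have := c ord_max ord0; have := c ord_max ord_max; rewrite /= => -> -> -> ->.
by rewrite /= /GRing.scale /= !mulr1 !mulr0 addr0 add0r.
Qed.

(** Both shapes of [omega] are [r + k s] with [2 r] in [{0, 1}]; this gives its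
    integral quadratic equation and its conjugate [2 r - omega] at once. *)
Lemma omega_equation : exists t n : int,
  omega d s ^+ 2 = t%:~R * omega d s - n%:~R /\
  forall a b : int,
    qconj s (a%:~R + b%:~R * omega d s) = a%:~R + b%:~R * (t%:~R - omega d s).
Proof.
have two0 : 2 != 0 :> K := prime_nat_neq0 K (isT : prime 2).
have scaleE (c : rat) : c *: s = c%:A * s by rewrite mulr_algl.
rewrite /omega; case: ifPn => [|_].
  rewrite eqz_mod_dvd => /dvdzP[q dE].
  have s2q : s ^+ 2 = q%:~R * 4 + 1 by rewrite s2 -[d](subrK 1) dE intrD intrM.
  exists 1, (- q); split.
    apply: (mulfI (mulf_neq0 two0 two0)); rewrite rmorphN /=.
    have -> : 2 * 2 * ((1 + s) / 2) ^+ 2 = (1 + s ^+ 2 + 2 * s) :> K by field.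
    by rewrite s2q; field.
  move=> a b.
  have half (c : int) : (c%:~R / 2%:R : rat)%:A = c%:~R / 2 :> K.
    by rewrite -[_%:A]/(in_alg K _) fmorph_div !rmorph_int rmorph_nat.
  have -> : a%:~R + b%:~R * ((1 + s) / 2) =
      ((a + a + b)%:~R / 2%:R : rat)%:A + (b%:~R / 2%:R : rat) *: s.
    by rewrite scaleE !half !intrD; field.
  by rewrite qconjE scaleE !half !intrD; field.
exists 0, (- d); split; first by rewrite s2 rmorphN /=; ring.
move=> a b; have := qconjE a%:~R b%:~R.
by rewrite !scaleE !scaler_int => ->; ring.
Qed.

Lemma max_order_coord :
  max_order d s =
  [set x | exists a b : int, x = a%:~R + b%:~R * omega d s].
Proof. by have [t [n [w2 _]]] := omega_equation; apply: Zadjoin_quadratic w2. Qed.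

Lemma max_order_quadratic : quadratic_ring (max_order d s) (qconj s).
Proof.
have [t [n [w2 conjE]]] := omega_equation.
rewrite max_order_coord; set w := omega d s in w2 conjE *.
have wE : w * w = t%:~R * w - n%:~R by rewrite -expr2.
have mulE (a b a' b' : int) : (a%:~R + b%:~R * w) * (a'%:~R + b'%:~R * w) =
    (a * a' - b * b' * n)%:~R + (a * b' + b * a' + b * b' * t)%:~R * w.
  rewrite mulrDl !mulrDr (mulrCA (b%:~R * w)) -(mulrA b%:~R w w) wE.
  by rewrite !rmorphD !rmorphM rmorphN !rmorphM /=; ring.
split.
- by exists 1, 0; ring.
- move=> _ _ [a [b ->]] [a' [b' ->]]; exists (a - a'), (b - b').
  by rewrite !rmorphB /=; ring.
- by move=> _ _ [a [b ->]] [a' [b' ->]]; rewrite mulE; do 2 eexists.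
- move=> _ [a [b ->]]; exists (a + a + b * t); rewrite conjE.
  by rewrite !rmorphD !rmorphM /=; ring.
- move=> _ [a [b ->]]; exists (a * a + a * b * t + b * b * n); rewrite conjE.
  transitivity (a%:~R * a%:~R + a%:~R * b%:~R * t%:~R +
    b%:~R * b%:~R * (w * t%:~R - w * w) : K); first by ring.
  by rewrite wE !rmorphD !rmorphM /=; ring.
- move=> _ _ [a [b ->]] [a' [b' ->]]; rewrite mulE !conjE.
  transitivity (a%:~R * a'%:~R +
    (a%:~R * b'%:~R + b%:~R * a'%:~R) * (t%:~R - w) +
    b%:~R * b'%:~R * (t%:~R * t%:~R - 2 * t%:~R * w + w * w) : K); last by ring.
  by rewrite wE !rmorphD !rmorphM rmorphN !rmorphM /=; ring.
- move=> _ [a [b ->]]; rewrite conjE.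
  have -> : a%:~R + b%:~R * (t%:~R - w) = (a + b * t)%:~R + (- b)%:~R * w.
    by rewrite !rmorphD !rmorphM rmorphN /=; ring.
  by rewrite conjE !rmorphD !rmorphM rmorphN /=; ring.
- by move=> a; have := conjE a 0; rewrite !mul0r !addr0.
Qed.

Lemma order_of_indexE (f : nat) :
  order_of_index d s f = order_of (max_order d s) f.
Proof.
have [t [n [w2 _]]] := omega_equation.
rewrite /order_of_index (@Zadjoin_quadratic _ _ (f%:Z * t) (f%:Z ^+ 2 * n)).
  rewrite max_order_coord; apply/seteqP; split=> y [a].
    by move=> [b ->]; exists a, (b%:~R * omega d s); [exists 0, b | ]; ring.
  move=> [_ [c [b ->]] ->]; exists (a + f%:Z * c), b.
  by rewrite rmorphD rmorphM /= -pmulrn; ring.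
by rewrite exprMn w2 !rmorphM /= -!pmulrn; ring.
Qed.

End QuadraticField.

Theorem theorem4p3 (d : int) (K : fieldExtType rat) (s : K) (f : nat)
    (P : set K) (m : nat) (beta : K) :
  squarefree d -> d <> 1 -> is_quadratic_field d s -> prime f ->
  let D := max_order d s in
  let O := order_of_index d s f in
  let F := conductor D O in
  let Pbar := qconj s @` P in
  prime_ideal D P -> prime_ideal D Pbar -> P <> Pbar ->
  principal D f%:R = ideal_mul P Pbar ->
  class_order D P m ->
  D beta -> ideal_exp D P m = principal D beta ->
  (forall t : K, O t ->
     (basic_element O F t <->
      exists n : nat, associated D t (tseq f beta n) \/
                      associated D t (qconj s (tseq f beta n))))
  /\
  (forall W : set K, unit_representatives D O W ->
     forall (b b' : bool) (n n' : nat) (w w' : K),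
       (0 < n)%N -> (0 < n')%N -> W w -> W w' -> (b, n, w) <> (b', n', w') ->
       incomparable (t_ideal s f beta O (b, n, w))
                    (t_ideal s f beta O (b', n', w')))
  /\
  (forall (b : bool) (n : nat) (w : K), (0 < n)%N -> units D w ->
     ~ (ideal_exp O F 2 `<=` t_ideal s f beta O (b, n, w))).
Proof.
move=> d_sqf d1 [s2 _] f_prime D O F Q Pp Qp PnQ FE Pm Db Pb.
have OE : O = order_of D f by apply: order_of_indexE.
rewrite {}/F; move: O OE => _ ->.
have Dq : quadratic_ring D (qconj s) := max_order_quadratic d_sqf d1 s2.
have QE : Q = qconj s @` P by [].
rewrite (conductorE Dq f_prime (order_proper Dq f_prime Pp Qp QE PnQ FE)).
have conj_tseq n : qconj s (tseq f beta n) = f%:R * qconj s beta ^+ n.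
  rewrite /tseq (conjM Dq); last exact: subringX (qring1 Dq) (qringM Dq) _ _ Db.
    by rewrite (conj_nat Dq) (conjX Dq).
  exact: subring_nat (qring1 Dq) (qringB Dq) _.
have t_idealE b n w : t_ideal s f beta (order_of D f) (b, n, w) =
    principal (order_of D f) (f%:R * gen (qconj s) beta b ^+ n * w).
  by case: b; rewrite /t_ideal ?conj_tseq.
split; [|split].
- move=> t Ot; rewrite (basic_element_gen Dq f_prime Pp Qp QE PnQ FE Pm Db Pb Ot).
  by split=> -[n h]; exists n; move: h; rewrite conj_tseq.
- move=> W [WD Wrep] b b' n n' w w' n_gt0 n'_gt0 Ww Ww' neq.
  suff main c c' k k' v v' : (0 < k)%N -> (0 < k')%N -> W v -> W v' ->
      principal (order_of D f) (f%:R * gen (qconj s) beta c ^+ k * v) `<=`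
      principal (order_of D f) (f%:R * gen (qconj s) beta c' ^+ k' * v') ->
      (c, k, v) = (c', k', v').
    rewrite !t_idealE; split=> /main h; apply: neq; first exact: h.
    by apply/esym/h.
  move=> k_gt0 k'_gt0 Wv Wv' sub.
  have [-> -> uv] := gen_ideal_sub Dq f_prime Pp Qp QE PnQ FE Pm Db Pb
    k_gt0 k'_gt0 (WD _ Wv) (WD _ Wv') sub.
  have [_ [z _ vz]] := WD _ Wv.
  have v0 : v != 0.
    by apply: contra_eq_neq vz => ->; rewrite mul0r eq_sym oner_eq0.
  have [x [_ x_uniq]] := Wrep v (WD _ Wv).
  have <- : x = v.
    apply: x_uniq; split=> //; rewrite mulfV //.
    have O1 := order1 f Dq; split=> //; exists 1 => //; exact: mulr1.
  by congr (_, _, _); apply: x_uniq.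
- move=> b n w n_gt0 uw; rewrite t_idealE.
  exact: (principal_sqr_nsub Dq f_prime Pp Qp QE PnQ FE Pm Db Pb).
Qed.
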